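(* There exists a $\mathbb{Q}(v)$-algebra automorphism $\mathbf{T}_1$ of $\widetilde{\mathbf U}^\imath$ such that $$\mathbf{T}_1(\mathbb{K}_1)= v^{-1}\mathbb{K}_2^{-1},\quad \mathbf{T}_1(\mathbb{K}_2)= v^{-1}\mathbb{K}_1^{-1},\quad \mathbf{T}_1(\mathbb{K}_0)= v^{2}\mathbb{K}_0\mathbb{K}_1^2\mathbb{K}_2^2,$$ $$\mathbf{T}_1(B_1)=-v^{-2}B_1\mathbb{K}_2^{-1},\qquad \mathbf{T}_1(B_2)=-v^{-2}B_2\mathbb{K}_1^{-1},$$ $$\mathbf{T}_1(B_0)= v\Big[\big[[B_0,B_1]_v,B_2\big],[B_2,B_1]_v\Big]-\big[B_0,[B_2,B_1]_{v^3}\big]\mathbb{K}_1+vB_0\mathbb{K}_1\mathbb{K}_2.$$ The inverse automorphism $\mathbf{T}_1^{-1}$ is given by $$\mathbf{T}_1^{-1}(\mathbb{K}_1)= v^{-1}\mathbb{K}_2^{-1},\quad \mathbf{T}_1^{-1}(\mathbb{K}_2)= v^{-1}\mathbb{K}_1^{-1},\quad \mathbf{T}_1^{-1}(\mathbb{K}_0)= v^{2}\mathbb{K}_0\mathbb{K}_1^2\mathbb{K}_2^2,$$ $$\mathbf{T}_1^{-1}(B_1)=-vB_1\mathbb{K}_1^{-1},\qquad \mathbf{T}_1^{-1}(B_2)=-vB_2\mathbb{K}_2^{-1},$$ $$\mathbf{T}_1^{-1}(B_0)= v\Big[[B_1,B_2]_v,\big[B_2,[B_1,B_0]_v\big]\Big]-\big[[B_1,B_2]_{v^3},B_0\big]\mathbb{K}_2+vB_0\mathbb{K}_1\mathbb{K}_2.$$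 Moreover, $\mathbf{T}_1$ and $\mathbf{T}_1^{-1}$ are related by conjugation by $\sigma_\tau$: $\mathbf{T}_1^{-1}=\sigma_\tau\circ\mathbf{T}_1\circ\sigma_\tau$.
   Context: Here $v$ is an indeterminate, $[n]=\frac{v^n-v^{-n}}{v-v^{-1}}$, $[A,B]_{v^a}=AB-v^aBA$ and $[A,B]=AB-BA$. Let $\mathbb{I}=\{0,1,2\}$, let $(c_{ij})_{i,j\in\mathbb{I}}$ be the Cartan matrix of affine type $A_2^{(1)}$ ($c_{ii}=2$, $c_{ij}=-1$ for $i\ne j$), and let $\tau$ be the involution of $\mathbb{I}$ with $\tau(0)=0$, $\tau(1)=2$, $\tau(2)=1$. The algebra $\widetilde{\mathbf U}^\imath$ (the universal quasi-split affine $\imath$quantum group associated with $(\mathbb{I},\tau)$) is the $\mathbb{Q}(v)$-algebra generated by $B_i$ and invertible elements $\mathbb{K}_i$ ($i\in\mathbb{I}$), subject to: $\mathbb{K}_i\mathbb{K}_j=\mathbb{K}_j\mathbb{K}_i$ and $\mathbb{K}_iB_j=v^{c_{\tau i,j}-c_{ij}}B_j\mathbb{K}_i$ for $i,j\in\mathbb{I}$; $B_2B_1^2-[2]B_1B_2B_1+B_1^2B_2=-[2](v\mathbb{K}_1B_1+vB_1\mathbb{K}_2)$; $B_1B_2^2-[2]B_2B_1B_2+B_2^2B_1=-[2](v\mathbb{K}_2B_2+vB_2\mathbb{K}_1)$; $B_0B_i^2-[2]B_iB_0B_i+B_i^2B_0=0$ for $i=1,2$; $B_iB_0^2-[2]B_0B_iB_0+B_0^2B_i=-v^{-1}\mathbb{K}_0B_i$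 for $i=1,2$. $\sigma_\tau$ denotes the $\mathbb{Q}(v)$-algebra anti-involution of $\widetilde{\mathbf U}^\imath$ with $\sigma_\tau(B_i)=B_i$ and $\sigma_\tau(\mathbb{K}_i)=\mathbb{K}_{\tau i}$ for all $i\in\mathbb{I}$. *)

(* Defs.v *)
From HB Require Import structures.
From mathcomp Require Import all_boot all_order perm all_algebra.
From mathcomp Require Import boolp.
From mathcomp Require Import monalg.

Set Implicit Arguments.
Unset Strict Implicit.
Unset Printing Implicit Defensive.

Import GRing.Theory.
Local Open Scope ring_scope.
Local Open Scope quotient_scope.

(* The field Q(v), v being the image of the polynomial variable. *)
Definition Qv : fieldType := {fraction {poly rat}}.
Definition v : Qv := tofrac 'X.

(* The quantum integer [n]. *)
Definition qint (n : int) : Qv := (v ^ n - v ^ (- n)) / (v - v^-1).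

Definition bracket (A : nzRingType) (x y : A) : A := x * y - y * x.

Definition qbracket (A : lalgType Qv) (a : Qv) (x y : A) : A :=
  x * y - a *: (y * x).

Definition i0 : 'I_3 := @Ordinal 3 0 isT.
Definition i1 : 'I_3 := @Ordinal 3 1 isT.
Definition i2 : 'I_3 := @Ordinal 3 2 isT.

(* The Cartan matrix of type A_2^(1). *)
Definition cartan (i j : 'I_3) : int := if i == j then 2 else - 1.

Definition tau : {perm 'I_3} := tperm i1 i2.

(* The defining relations, as pairs (left-hand side, right-hand side), for
   families B, K, KV in an arbitrary algebra; KV i is the inverse of K i. *)
Section Relations.
Variables (A : lalgType Qv) (B K KV : 'I_3 -> A).

Inductive iqg_rel : A -> A -> Prop :=
| rel_KKV i : iqg_rel (K i * KV i) 1
| rel_KVK i : iqg_rel (KV i * K i) 1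
| rel_KK i j : iqg_rel (K i * K j) (K j * K i)
| rel_KB i j :
    iqg_rel (K i * B j) (v ^ (cartan (tau i) j - cartan i j) *: (B j * K i))
| rel_B2B1 :
    iqg_rel
      (B i2 * B i1 ^+ 2 - qint 2 *: (B i1 * B i2 * B i1) + B i1 ^+ 2 * B i2)
      (- (qint 2 *: (v *: (K i1 * B i1) + v *: (B i1 * K i2))))
| rel_B1B2 :
    iqg_rel
      (B i1 * B i2 ^+ 2 - qint 2 *: (B i2 * B i1 * B i2) + B i2 ^+ 2 * B i1)
      (- (qint 2 *: (v *: (K i2 * B i2) + v *: (B i2 * K i1))))
| rel_B0Bi i : i != i0 ->
    iqg_rel
      (B i0 * B i ^+ 2 - qint 2 *: (B i * B i0 * B i) + B i ^+ 2 * B i0)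
      0
| rel_BiB0 i : i != i0 ->
    iqg_rel
      (B i * B i0 ^+ 2 - qint 2 *: (B i0 * B i * B i0) + B i0 ^+ 2 * B i)
      (- (v^-1 *: (K i0 * B i))).

Definition iqg_family := forall x y, iqg_rel x y -> x = y.

End Relations.

Lemma iqg_rel_morph (A A' : lalgType Qv) (phi : {lrmorphism A -> A'})
  (B K KV : 'I_3 -> A) x y : iqg_rel B K KV x y ->
  iqg_rel (phi \o B) (phi \o K) (phi \o KV) (phi x) (phi y).
Proof.
have phiE := (linearB phi, linearD phi, linearN phi, linearZ_LR phi,
  rmorphXn phi, rmorphM phi).
case=> [i|i|i j|i j|||i i_n0|i i_n0].
- by rewrite rmorphM rmorph1; apply: (rel_KKV (phi \o B) (phi \o K)).
- by rewrite rmorphM rmorph1; apply: (rel_KVK (phi \o B) (phi \o K)).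
- by rewrite 2!rmorphM; apply: (rel_KK (phi \o B) (phi \o K)).
- by rewrite linearZ_LR 2!rmorphM; apply: (rel_KB (phi \o B) (phi \o K)).
- by rewrite !phiE; apply: (rel_B2B1 (phi \o B) (phi \o K)).
- by rewrite !phiE; apply: (rel_B1B2 (phi \o B) (phi \o K)).
- rewrite raddf0 !phiE; exact: (rel_B0Bi (phi \o B) (phi \o K) _ i_n0).
- rewrite !phiE; exact: (rel_BiB0 (phi \o B) (phi \o K) _ i_n0).
Qed.

Lemma iqg_family_morph (A A' : lalgType Qv) (phi : {lrmorphism A -> A'})
  (B K KV : 'I_3 -> A) :
  (forall x y, iqg_rel B K KV x y -> phi x = phi y) ->
  iqg_family (phi \o B) (phi \o K) (phi \o KV).
Proof.
have phiE := (linearB phi, linearD phi, linearN phi, linearZ_LR phi,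
  rmorphXn phi, rmorphM phi).
move=> phiP x y [i|i|i j|i j|||i i_n0|i i_n0] /=.
- by have := phiP _ _ (rel_KKV B K KV i); rewrite rmorphM rmorph1.
- by have := phiP _ _ (rel_KVK B K KV i); rewrite rmorphM rmorph1.
- by have := phiP _ _ (rel_KK B K KV i j); rewrite 2!rmorphM.
- by have := phiP _ _ (rel_KB B K KV i j); rewrite linearZ_LR 2!rmorphM.
- by have := phiP _ _ (rel_B2B1 B K KV); rewrite !phiE.
- by have := phiP _ _ (rel_B1B2 B K KV); rewrite !phiE.
- by have := phiP _ _ (rel_B0Bi B K KV i_n0); rewrite raddf0 !phiE.
- by have := phiP _ _ (rel_BiB0 B K KV i_n0); rewrite !phiE.
Qed.

Inductive iqg_gen := GenB of 'I_3 | GenK of 'I_3 | GenKV of 'I_3.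

Definition iqg_gen_code (g : iqg_gen) : 'I_3 + 'I_3 + 'I_3 :=
  match g with GenB i => inl (inl i) | GenK i => inl (inr i) | GenKV i => inr i
  end.
Definition iqg_gen_decode (c : 'I_3 + 'I_3 + 'I_3) : iqg_gen :=
  match c with inl (inl i) => GenB i | inl (inr i) => GenK i | inr i => GenKV i
  end.
Lemma iqg_gen_codeK : cancel iqg_gen_code iqg_gen_decode.
Proof. by case. Qed.

HB.instance Definition _ := Choice.copy iqg_gen (can_type iqg_gen_codeK).

(* The free associative algebra on the generators: the algebra of the free
   monoid of words. *)
Notation iqg_free := {malg Qv[{fmonom iqg_gen}]}.

Lemma malg_scaleAr (M : monomType) (R : comNzRingType) (c : R)
  (x y : {malg R[M]}) : c *: (x * y) = x * (c *: y).
Proof.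
rewrite -2!mul_malgC 2!mulrA; congr (_ * _).
rewrite !malgM_def /malgC fgmulUg fgmulgU; apply: eq_bigr => k _.
by rewrite mul1m mulm1 mulrC.
Qed.

Lemma malgUZ (M : monomType) (R : comNzRingType) (c : R) (m : M) :
  << c *g m >> = c *: << m >> :> {malg R[M]}.
Proof. by apply/malgP => k; rewrite mcoeffZ !mcoeffU mulr_natr. Qed.

Lemma malgU_cons (I : choiceType) (R : comNzRingType) (i : I) (s : seq I) :
  << FMonom (i :: s) >> = << fmu i >> * << FMonom s >> :> {malg R[{fmonom I}]}.
Proof.
rewrite malgM_def fgmulUU mulr1; congr << _ *g _ >>.
by apply/eqP; rewrite fmP fmM fmU.
Qed.

Section FreeLift.
Variables (A : algType Qv) (f : iqg_gen -> A).

Definition word_prod (m : {fmonom iqg_gen}) : A := \prod_(g <- m) f g.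

Lemma word_prod_mmorphism : mmorphism word_prod.
Proof.
split=> [m1 m2|]; rewrite /word_prod.
  by rewrite fmM big_cat.
by rewrite fm1 big_nil.
Qed.
HB.instance Definition _ :=
  isMultiplicative.Build {fmonom iqg_gen} A word_prod word_prod_mmorphism.

Definition free_lift : iqg_free -> A := mmap (in_alg A) word_prod.

Lemma free_lift_monoid_morphism : monoid_morphism free_lift.
Proof.
have [] := @commr_mmap_is_multiplicative _ _ _ (in_alg A) word_prod.
  by move=> g m m'; rewrite /GRing.comm /= -scalerAl -scalerAr mul1r mulr1.
by move=> h1 h2; split.
Qed.
HB.instance Definition _ :=
  GRing.Additive.copy free_lift (mmap (in_alg A) word_prod).
HB.instance Definition _ :=
  GRing.isMonoidMorphism.Build iqg_free A free_lift free_lift_monoid_morphism.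

Lemma free_lift_scalable : scalable free_lift.
Proof. by move=> c x; rewrite /free_lift mmapZ /= mulr_algl. Qed.
HB.instance Definition _ :=
  GRing.isScalable.Build Qv iqg_free A *:%R free_lift free_lift_scalable.

Lemma free_liftU g : free_lift << fmu g >> = f g.
Proof.
by rewrite /free_lift mmapU /= scale1r mul1r /word_prod fmU big_seq1.
Qed.

End FreeLift.

Definition freeB i : iqg_free := << fmu (GenB i) >>.
Definition freeK i : iqg_free := << fmu (GenK i) >>.
Definition freeKV i : iqg_free := << fmu (GenKV i) >>.

(* The two-sided ideal generated by the differences of the two sides of the
   defining relations. *)
Inductive iqg_ideal : iqg_free -> Prop :=
| ideal_rel x y : iqg_rel freeB freeK freeKV x y -> iqg_ideal (x - y)
| ideal_0 : iqg_ideal 0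
| ideal_add x y : iqg_ideal x -> iqg_ideal y -> iqg_ideal (x + y)
| ideal_mul a x b : iqg_ideal x -> iqg_ideal (a * x * b).

Lemma ideal_mull a x : iqg_ideal x -> iqg_ideal (a * x).
Proof. by move=> h; rewrite -[_ * _]mulr1; apply: ideal_mul. Qed.

Lemma ideal_mulr x b : iqg_ideal x -> iqg_ideal (x * b).
Proof. by move=> h; rewrite -[x]mul1r; apply: ideal_mul. Qed.

Lemma ideal_opp x : iqg_ideal x -> iqg_ideal (- x).
Proof. by move=> h; rewrite -mulN1r; apply: ideal_mull. Qed.

Lemma ideal_scale c x : iqg_ideal x -> iqg_ideal (c *: x).
Proof. by move=> h; rewrite -mul_malgC; apply: ideal_mull. Qed.

Definition iqg_equiv : rel iqg_free := fun x y => `[< iqg_ideal (x - y) >].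

Lemma iqg_equivP x y : reflect (iqg_ideal (x - y)) (iqg_equiv x y).
Proof. exact: asboolP. Qed.

Lemma iqg_equiv_class : equiv_class_of iqg_equiv.
Proof.
split=> [x|x y|y x z].
- by apply/iqg_equivP; rewrite subrr; apply: ideal_0.
- by apply/iqg_equivP/iqg_equivP => /ideal_opp; rewrite opprB.
- move=> /iqg_equivP h1 /iqg_equivP h2; apply/iqg_equivP.
  by rewrite -(subrKA y x); apply: ideal_add.
Qed.
Canonical iqg_equivRel := EquivRelPack iqg_equiv_class.

Definition iqg := {eq_quot iqg_equivRel}.
HB.instance Definition _ := Choice.on iqg.
HB.instance Definition _ := EqQuotient.on iqg.

(* The projection and the operations are locked, so that unification does not
   compute with representatives. *)
HB.lock Definition iqg_pi (x : iqg_free) : iqg := \pi_iqg x.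

Lemma iqg_piP x y : iqg_pi x = iqg_pi y <-> iqg_ideal (x - y).
Proof.
by rewrite iqg_pi.unlock; split=> [/eqquotP/iqg_equivP|h] //;
  apply/eqquotP/iqg_equivP.
Qed.

Lemma iqg_piK x : iqg_ideal (repr (iqg_pi x) - x).
Proof. by apply/iqg_piP; rewrite iqg_pi.unlock reprK. Qed.

Lemma iqg_piW (P : iqg -> Prop) : (forall x, P (iqg_pi x)) -> forall u, P u.
Proof. by move=> h u; have := h (repr u); rewrite iqg_pi.unlock reprK. Qed.

HB.lock Definition iqg_add (u w : iqg) : iqg := iqg_pi (repr u + repr w).
HB.lock Definition iqg_opp (u : iqg) : iqg := iqg_pi (- repr u).
HB.lock Definition iqg_mul (u w : iqg) : iqg := iqg_pi (repr u * repr w).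
HB.lock Definition iqg_scale (c : Qv) (u : iqg) : iqg := iqg_pi (c *: repr u).

Lemma iqg_addE x y : iqg_add (iqg_pi x) (iqg_pi y) = iqg_pi (x + y).
Proof.
rewrite iqg_add.unlock; apply/iqg_piP; rewrite opprD addrACA;
  by apply: ideal_add; apply: iqg_piK.
Qed.

Lemma iqg_oppE x : iqg_opp (iqg_pi x) = iqg_pi (- x).
Proof.
rewrite iqg_opp.unlock; apply/iqg_piP; rewrite -opprD;
  by apply: ideal_opp; apply: iqg_piK.
Qed.

Lemma iqg_scaleE c x : iqg_scale c (iqg_pi x) = iqg_pi (c *: x).
Proof.
rewrite iqg_scale.unlock; apply/iqg_piP; rewrite -scalerBr;
  by apply: ideal_scale; apply: iqg_piK.
Qed.

Lemma iqg_mulE x y : iqg_mul (iqg_pi x) (iqg_pi y) = iqg_pi (x * y).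
Proof.
have mulBE (R : nzRingType) (a b c d : R) :
  a * b - c * d = a * (b - d) + (a - c) * d by rewrite mulrBr mulrBl subrKA.
rewrite iqg_mul.unlock; apply/iqg_piP; rewrite mulBE; apply: ideal_add.
  exact: ideal_mull (iqg_piK y).
exact: ideal_mulr (iqg_piK x).
Qed.

Lemma iqg_addA : associative iqg_add.
Proof. by do 3![elim/iqg_piW => ?]; rewrite !iqg_addE addrA. Qed.
Lemma iqg_addC : commutative iqg_add.
Proof. by do 2![elim/iqg_piW => ?]; rewrite !iqg_addE addrC. Qed.
Lemma iqg_add0 : left_id (iqg_pi 0) iqg_add.
Proof. by elim/iqg_piW => ?; rewrite !iqg_addE add0r. Qed.
Lemma iqg_addN : left_inverse (iqg_pi 0) iqg_opp iqg_add.
Proof. by elim/iqg_piW => ?; rewrite !iqg_oppE iqg_addE addNr. Qed.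
HB.instance Definition _ :=
  GRing.isZmodule.Build iqg iqg_addA iqg_addC iqg_add0 iqg_addN.

Lemma iqg_mulA : associative iqg_mul.
Proof. by do 3![elim/iqg_piW => ?]; rewrite !iqg_mulE mulrA. Qed.
Lemma iqg_mul1 : left_id (iqg_pi 1) iqg_mul.
Proof. by elim/iqg_piW => ?; rewrite !iqg_mulE mul1r. Qed.
Lemma iqg_mulr1 : right_id (iqg_pi 1) iqg_mul.
Proof. by elim/iqg_piW => ?; rewrite !iqg_mulE mulr1. Qed.
Lemma iqg_mulDl : left_distributive iqg_mul +%R.
Proof.
by do 3![elim/iqg_piW => ?]; rewrite /+%R /= !(iqg_mulE, iqg_addE) mulrDl.
Qed.
Lemma iqg_mulDr : right_distributive iqg_mul +%R.
Proof.
by do 3![elim/iqg_piW => ?]; rewrite /+%R /= !(iqg_mulE, iqg_addE) mulrDr.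
Qed.

Definition gen_map T (B K KV : 'I_3 -> T) (g : iqg_gen) : T :=
  match g with GenB i => B i | GenK i => K i | GenKV i => KV i end.

Lemma free_lift_ideal (A : algType Qv) (B K KV : 'I_3 -> A) x :
  iqg_family B K KV -> iqg_ideal x -> free_lift (gen_map B K KV) x = 0.
Proof.
move=> BKP; elim=> {x} [x y /(iqg_rel_morph (free_lift (gen_map B K KV))) xy|
  |x y _ ex _ ey|a x b _ ex].
- rewrite raddfB /=; apply/eqP; rewrite subr_eq0; apply/eqP/BKP.
  congr iqg_rel: xy; apply/funext => i /=; exact: free_liftU.
- exact: raddf0.
- by rewrite raddfD /= ex ey addr0.
- by rewrite !rmorphM /= ex mulr0 mul0r.
Qed.

(* Non-triviality of the quotient: B i |-> 0, K i |-> 1 is a character. *)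
Lemma iqg_family01 :
  @iqg_family Qv^o (fun=> 0) (fun=> 1) (fun=> 1).
Proof.
by move=> x y []*; rewrite ?(mul0r, mulr0, scaler0, addr0, subr0, oppr0, mulr1).
Qed.

Lemma iqg_oner_neq0 : iqg_pi 1 != 0.
Proof.
apply/eqP => /iqg_piP; rewrite subr0 => /(free_lift_ideal iqg_family01).
by rewrite rmorph1 => /eqP; rewrite oner_eq0.
Qed.

HB.instance Definition _ := GRing.Zmodule_isNzRing.Build iqg
  iqg_mulA iqg_mul1 iqg_mulr1 iqg_mulDl iqg_mulDr iqg_oner_neq0.

Lemma iqg_scaleA c d u : iqg_scale c (iqg_scale d u) = iqg_scale (c * d) u.
Proof. by elim/iqg_piW: u => ?; rewrite !iqg_scaleE scalerA. Qed.
Lemma iqg_scale1 : left_id 1 iqg_scale.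
Proof. by elim/iqg_piW => ?; rewrite iqg_scaleE scale1r. Qed.
Lemma iqg_scaleDr : right_distributive iqg_scale +%R.
Proof.
by move=> c; do 2![elim/iqg_piW => ?];
  rewrite /+%R /= !(iqg_scaleE, iqg_addE) scalerDr.
Qed.
Lemma iqg_scaleDl u : {morph iqg_scale^~ u : c d / c + d}.
Proof.
by move=> c d /=; elim/iqg_piW: u => ?;
  rewrite [in RHS]/+%R /= !(iqg_scaleE, iqg_addE) scalerDl.
Qed.
HB.instance Definition _ := GRing.Zmodule_isLmodule.Build Qv iqg
  iqg_scaleA iqg_scale1 iqg_scaleDr iqg_scaleDl.

Lemma iqg_scaleAl c (u w : iqg) : c *: (u * w) = (c *: u) * w.
Proof.
elim/iqg_piW: u => x; elim/iqg_piW: w => y.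
by rewrite /*:%R /*%R /= !(iqg_mulE, iqg_scaleE) scalerAl.
Qed.
HB.instance Definition _ := GRing.Lmodule_isLalgebra.Build Qv iqg iqg_scaleAl.

Lemma iqg_scaleAr c (u w : iqg) : c *: (u * w) = u * (c *: w).
Proof.
elim/iqg_piW: u => x; elim/iqg_piW: w => y.
by rewrite /*:%R /*%R /= !(iqg_mulE, iqg_scaleE) malg_scaleAr.
Qed.
HB.instance Definition _ := GRing.Lalgebra_isAlgebra.Build Qv iqg iqg_scaleAr.

Lemma iqg_pi_additive : {morph iqg_pi : x y / x - y}.
Proof. by move=> x y; rewrite -[RHS]/(iqg_add _ (iqg_opp _)) iqg_oppE iqg_addE. Qed.
HB.instance Definition _ :=
  GRing.isZmodMorphism.Build iqg_free iqg iqg_pi iqg_pi_additive.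
Lemma iqg_pi_monoid : monoid_morphism iqg_pi.
Proof. by split; [|move=> x y; exact/esym/iqg_mulE]. Qed.
HB.instance Definition _ :=
  GRing.isMonoidMorphism.Build iqg_free iqg iqg_pi iqg_pi_monoid.
Lemma iqg_pi_scalable : scalable iqg_pi.
Proof. by move=> c x; exact/esym/iqg_scaleE. Qed.
HB.instance Definition _ :=
  GRing.isScalable.Build Qv iqg_free iqg *:%R iqg_pi iqg_pi_scalable.

Definition iB i : iqg := iqg_pi (freeB i).
Definition iK i : iqg := iqg_pi (freeK i).
Definition iKV i : iqg := iqg_pi (freeKV i).

Lemma iqg_familyP : iqg_family iB iK iKV.
Proof.
apply: (@iqg_family_morph _ _ iqg_pi freeB freeK freeKV) => x y xy.
exact/iqg_piP/ideal_rel.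
Qed.

Section UniversalProperty.
Variables (A : algType Qv) (B K KV : 'I_3 -> A).
Hypothesis BKP : iqg_family B K KV.

Definition iqg_lift_fun (u : iqg) : A := free_lift (gen_map B K KV) (repr u).

Lemma iqg_lift_pi x : iqg_lift_fun (iqg_pi x) = free_lift (gen_map B K KV) x.
Proof.
apply/eqP; rewrite -subr_eq0 -raddfB; apply/eqP.
by apply: (free_lift_ideal BKP); apply: iqg_piK.
Qed.

Lemma iqg_lift_additive : {morph iqg_lift_fun : u w / u - w}.
Proof.
move=> u w; elim/iqg_piW: u => x; elim/iqg_piW: w => y.
by rewrite -raddfB !iqg_lift_pi raddfB.
Qed.

Lemma iqg_lift_monoid : monoid_morphism iqg_lift_fun.
Proof.
split=> [|u w]; first by rewrite -(rmorph1 iqg_pi) iqg_lift_pi rmorph1.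
elim/iqg_piW: u => x; elim/iqg_piW: w => y.
by rewrite -rmorphM !iqg_lift_pi rmorphM.
Qed.

Lemma iqg_lift_scalable : scalable iqg_lift_fun.
Proof.
move=> c u; elim/iqg_piW: u => x.
by rewrite -linearZ_LR !iqg_lift_pi linearZ_LR.
Qed.

HB.instance Definition _ :=
  GRing.isZmodMorphism.Build iqg A iqg_lift_fun iqg_lift_additive.
HB.instance Definition _ :=
  GRing.isMonoidMorphism.Build iqg A iqg_lift_fun iqg_lift_monoid.
HB.instance Definition _ :=
  GRing.isScalable.Build Qv iqg A *:%R iqg_lift_fun iqg_lift_scalable.

Definition iqg_lift : {lrmorphism iqg -> A} := iqg_lift_fun.

Lemma iqg_lift_iB i : iqg_lift (iB i) = B i.
Proof. by rewrite /= iqg_lift_pi free_liftU. Qed.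
Lemma iqg_lift_iK i : iqg_lift (iK i) = K i.
Proof. by rewrite /= iqg_lift_pi free_liftU. Qed.
Lemma iqg_lift_iKV i : iqg_lift (iKV i) = KV i.
Proof. by rewrite /= iqg_lift_pi free_liftU. Qed.

End UniversalProperty.

Lemma iqg_ind (P : iqg -> Prop) :
  P 1 -> (forall i, P (iB i)) -> (forall i, P (iK i)) -> (forall i, P (iKV i)) ->
  (forall c u w, P u -> P w -> P (c *: u + w)) ->
  (forall u w, P u -> P w -> P (u * w)) -> forall u, P u.
Proof.
move=> P1 PB PK PKV Plin Pmul; elim/iqg_piW => x.
have P0 : P 0 by rewrite -[0](addNr 1) -scaleN1r; apply: Plin.
have piZ c y : iqg_pi (c *: y) = c *: iqg_pi y := linearZ_LR iqg_pi c y.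
have piM y z : iqg_pi (y * z) = iqg_pi y * iqg_pi z := rmorphM iqg_pi y z.
rewrite [x]monalgE raddf_sum /=; elim/big_rec: _ => // m y _ Py.
rewrite malgUZ piZ; apply: Plin Py.
case: m => s; elim: s => [|g s IHs].
  by rewrite -fmoneE; move: P1; rewrite -(rmorph1 iqg_pi).
by rewrite malgU_cons piM; apply: Pmul IHs; case: g.
Qed.

(* A^c, the converse ring, is given the R-module structure of A. *)
Section Converse.
Variables (R : pzRingType) (A : algType R).
HB.instance Definition _ := GRing.Lmodule.on A^c.
Lemma converse_scaleAl c (x y : A^c) : c *: (x * y) = (c *: x : A^c) * y.
Proof. exact: (@scalerAr R A c y x). Qed.
HB.instance Definition _ :=
  GRing.Lmodule_isLalgebra.Build R A^c converse_scaleAl.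
Lemma converse_scaleAr c (x y : A^c) : c *: (x * y) = x * (c *: y : A^c).
Proof. exact: (@scalerAl R A c y x). Qed.
HB.instance Definition _ :=
  GRing.Lalgebra_isAlgebra.Build R A^c converse_scaleAr.
End Converse.

Lemma v_neq0 : v != 0.
Proof. by rewrite /v tofrac_eq0 polyX_eq0. Qed.

Lemma iqg_family_converse (A : algType Qv) (B K KV : 'I_3 -> A) :
  iqg_family B K KV -> @iqg_family A^c B (K \o tau) (KV \o tau).
Proof.
move=> BKP.
have t0 : tau i0 = i0 by rewrite tpermD.
have t1 : tau i1 = i2 by rewrite tpermL.
have t2 : tau i2 = i1 by rewrite tpermR.
have serreE (x y z : A) :
    y * x ^+ 2 - qint 2 *: (x * y * x) + x ^+ 2 * y = z ->
    x ^+ 2 * y - qint 2 *: (x * (y * x)) + y * x ^+ 2 = z.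
  by move=> <-; rewrite mulrA addrAC [_ + y * _]addrC addrAC.
have KBE i j :
    B j * K (tau i) = v ^ (cartan (tau i) j - cartan i j) *: (K (tau i) * B j).
  rewrite (BKP _ _ (rel_KB B K KV (tau i) j)) tpermK scalerA -expfzDr ?v_neq0 //.
  by rewrite addrC subrKA subrr expr0z scale1r.
have K0B j : j != i0 -> K i0 * B j = B j * K i0.
  by rewrite (BKP _ _ (rel_KB B K KV i0 j)) t0 subrr expr0z scale1r.
move=> x y [i|i|i j|i j|||i i_n0|i i_n0] /=.
- exact (BKP _ _ (rel_KVK B K KV (tau i))).
- exact (BKP _ _ (rel_KKV B K KV (tau i))).
- exact (BKP _ _ (rel_KK B K KV (tau j) (tau i))).
- exact (KBE i j).
- rewrite t1 t2; refine (serreE (B i1) (B i2) _ _).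
  by rewrite (BKP _ _ (rel_B2B1 B K KV)) addrC.
- rewrite t1 t2; refine (serreE (B i2) (B i1) _ _).
  by rewrite (BKP _ _ (rel_B1B2 B K KV)) addrC.
- exact (serreE (B i) (B i0) _ (BKP _ _ (rel_B0Bi B K KV i_n0))).
- rewrite t0; refine (serreE (B i0) (B i) _ _).
  by rewrite (BKP _ _ (rel_BiB0 B K KV i_n0)) K0B.
Qed.

(* An anti-endomorphism of iqg is an algebra morphism to the opposite
   algebra. *)
Definition sigma_tau : iqg -> iqg :=
  iqg_lift (iqg_family_converse iqg_familyP) : iqg -> iqg^c.

Lemma sigma_tau_linear : linear sigma_tau.
Proof. exact: (linearP (iqg_lift (iqg_family_converse iqg_familyP))). Qed.

Lemma sigma_tau1 : sigma_tau 1 = 1.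
Proof. exact: (rmorph1 (iqg_lift (iqg_family_converse iqg_familyP))). Qed.

Lemma sigma_tauM : {morph sigma_tau : x y / x * y >-> y * x}.
Proof. exact: (rmorphM (iqg_lift (iqg_family_converse iqg_familyP))). Qed.

Lemma sigma_tau_iB i : sigma_tau (iB i) = iB i.
Proof. exact: (iqg_lift_iB (iqg_family_converse iqg_familyP)). Qed.

Lemma sigma_tau_iK i : sigma_tau (iK i) = iK (tau i).
Proof. exact: (iqg_lift_iK (iqg_family_converse iqg_familyP)). Qed.

Lemma sigma_tau_iKV i : sigma_tau (iKV i) = iKV (tau i).
Proof. exact: (iqg_lift_iKV (iqg_family_converse iqg_familyP)). Qed.

Lemma sigma_tauK : involutive sigma_tau.
Proof.
move=> u; elim/iqg_ind: u => [|i|i|i|c u w IHu IHw|u w IHu IHw].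
- by rewrite !sigma_tau1.
- by rewrite !sigma_tau_iB.
- by rewrite !sigma_tau_iK tpermK.
- by rewrite !sigma_tau_iKV tpermK.
- by rewrite !sigma_tau_linear IHu IHw.
- by rewrite !sigma_tauM IHu IHw.
Qed.

(* Main.v *)
From HB Require Import structures.
Require Import Defs.
From mathcomp Require Import all_boot all_order perm all_algebra.
Import GRing.Theory.
Local Open Scope ring_scope.

Set Implicit Arguments.
Unset Strict Implicit.
Unset Printing Implicit Defensive.

(** Among the defining relations, those of degree at most one in B_0 say that
    v-commutators with B_1 and B_2 generate from B_0 eight root vectors that
    are arranged like the weight vectors of the adjoint representation of sl_3:
    B_0 is the lowest one, and the highest one, aff1212, is T_1(B_0)
    (aff1212E).  The right product of a root vector by B_1 is a power of v times
    the left product, plus the next vector in the direction of alpha_1, plus K_2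
    times the previous vector in the direction of alpha_2; in the same way B_2
    raises along alpha_2 and, with K_1, lowers along alpha_1.  The resulting
    multiplication table follows from the Serre relations and is invariant under
    the diagram automorphism.

    T_1 multiplies B_1 by K_2^-1 and B_2 by K_1^-1, and this exchanges raising
    with lowering.  Hence the anti-endomorphism phi = T_1 o sigma_tau turns the
    adjoint representation upside down: it exchanges B_0 with aff1212, aff1 with
    aff121, and the two vectors of weight delta with each other (phi_aff1 to
    phi_aff1212).  So phi is an involution.  Since sigma_tau is one too, it
    follows that T_1 is bijective with inverse sigma_tau o T_1 o sigma_tau, and
    the formulas for the inverse are the images under sigma_tau of those for
    T_1.

    The endomorphism T_1 exists because the proposed images of the generators
    satisfy the defining relations (braid_family).  For the relations of degree
    at most one in B_0 this can be read off the table.  The relation quadratic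
    in T_1(B_0) amounts to a v-commutation relation between the highest vector
    aff1212 and its neighbour aff121.  It is obtained from the v-commutation
    relation between B_0 and aff1, which is the quadratic Serre relation, by
    raising the latter from the bottom to the top of a ten-dimensional
    representation of sl_3 (aff121_aff1212).

    The individual identities are equalities of normal forms modulo rules for
    moving one letter past another.  They are verified by the tactic nc, which
    computes with noncommutative polynomials over Z[v, v^-1]. *)

(** * Normal forms in noncommutative algebras *)

Inductive scalar_expr :=
| SV of int
| SAdd of scalar_expr & scalar_expr
| SMul of scalar_expr & scalar_expr.

Inductive nc_expr :=
| NVar of nat
| NOne
| NZero
| NAdd of nc_expr & nc_expr
| NOpp of nc_expr
| NMul of nc_expr & nc_expr
| NScale of scalar_expr & nc_expr.

Fixpoint scalar_eval (s : scalar_expr) : Qv :=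
  match s with
  | SV e => v ^ e
  | SAdd s t => scalar_eval s + scalar_eval t
  | SMul s t => scalar_eval s * scalar_eval t
  end.

(** The monomial (c, e, w) stands for c v^e w.  Words are stored backwards, so
    that multiplying on the right by a letter acts on the head of the list. *)
Definition nc_mono : Type := int * int * seq nat.
Definition nc_poly := seq nc_mono.

Fixpoint add_mono (c e : int) (w : seq nat) (p : nc_poly) : nc_poly :=
  match p with
  | [::] => [:: (c, e, w)]
  | (c', e', w') :: q =>
      if (e == e') && (w == w') then
        let d := c + c' in if d == 0 then q else (d, e, w) :: q
      else (c', e', w') :: add_mono c e w q
  end.

Definition add_poly (p q : nc_poly) : nc_poly :=
  foldr (fun '(c, e, w) r => add_mono c e w r) q p.

Definition shift_poly (c e : int) (p : nc_poly) : nc_poly :=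
  [seq (let '(c', e', w) := m in (c * c', e + e', w)) | m <- p].

Fixpoint scale_poly (s : scalar_expr) (p : nc_poly) : nc_poly :=
  match s with
  | SV e => shift_poly 1 e p
  | SAdd s t => add_poly (scale_poly s p) (scale_poly t p)
  | SMul s t => scale_poly s (scale_poly t p)
  end.

(** A rule (a, i, e) rewrites the product of the letters a and i into e. *)
Definition nc_rule : Type := nat * nat * nc_expr.

Section Normalise.
Variable rs : seq nc_rule.

Fixpoint lookup (a i : nat) (l : seq nc_rule) : option nc_expr :=
  match l with
  | [::] => None
  | (a', i', e) :: l' =>
      if (a == a') && (i == i') then Some e else lookup a i l'
  end.

(** Right multiplication by an expression reduces to right multiplication of a
    word by a letter.  Working from the left to the right keeps the left factor
    normal throughout, which is why rules for pairs of letters are enough. *)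
Fixpoint mul_poly (mul_letter : seq nat -> nat -> nc_poly) (p : nc_poly)
    (e : nc_expr) : nc_poly :=
  match e with
  | NVar i =>
      foldr (fun '(c, e, w) r => add_poly (shift_poly c e (mul_letter w i)) r)
        [::] p
  | NOne => p
  | NZero => [::]
  | NAdd a b => add_poly (mul_poly mul_letter p a) (mul_poly mul_letter p b)
  | NOpp a => shift_poly (-1) 0 (mul_poly mul_letter p a)
  | NMul a b => mul_poly mul_letter (mul_poly mul_letter p a) b
  | NScale s a => mul_poly mul_letter (scale_poly s p) a
  end.

(** The counter n bounds the depth of nested rewriting; at depth 0 the product
    is left as it is, so soundness does not depend on termination. *)
Fixpoint mul_letter (n : nat) (w : seq nat) (i : nat) : nc_poly :=
  let stuck := [:: (1, 0, i :: w)] in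
  match n, w with
  | n'.+1, a :: w' =>
      if lookup a i rs is Some e then
        mul_poly (mul_letter n') [:: (1, 0, w')] e
      else stuck
  | _, _ => stuck
  end.

Definition normalise (e : nc_expr) : nc_poly :=
  mul_poly (mul_letter 100) [:: (1, 0, [::])] e.

End Normalise.

Section Soundness.
Variables (A : algType Qv) (env : seq A).

Fixpoint nc_eval (e : nc_expr) : A :=
  match e with
  | NVar i => nth 0 env i
  | NOne => 1
  | NZero => 0
  | NAdd a b => nc_eval a + nc_eval b
  | NOpp a => - nc_eval a
  | NMul a b => nc_eval a * nc_eval b
  | NScale s a => scalar_eval s *: nc_eval a
  end.

Fixpoint rules_hold (l : seq nc_rule) : Prop :=
  match l with
  | [::] => True
  | (a, i, e) :: l' => nth 0 env a * nth 0 env i = nc_eval e /\ rules_hold l'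
  end.

Definition word_eval (w : seq nat) : A :=
  foldr (fun i a => a * nth 0 env i) 1 w.
Definition mono_eval (m : nc_mono) : A :=
  let '(c, e, w) := m in (c%:~R * v ^ e) *: word_eval w.
Definition poly_eval (p : nc_poly) : A := foldr (fun m a => mono_eval m + a) 0 p.

Lemma poly_eval_add_mono c e w p :
  poly_eval (add_mono c e w p) = mono_eval (c, e, w) + poly_eval p.
Proof.
elim: p => [|[[c' e'] w'] q IHq] //=.
case: andP => [[/eqP<- /eqP<-]|_] /=; last by rewrite IHq addrCA.
rewrite addrA -scalerDl -mulrDl -rmorphD /=.
by case: eqP => [->|//]; rewrite mul0r scale0r add0r.
Qed.

Lemma poly_eval_add p q : poly_eval (add_poly p q) = poly_eval p + poly_eval q.
Proof.
elim: p => [|[[c e] w] p IHp] /=; first by rewrite add0r.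
by rewrite poly_eval_add_mono IHp addrA.
Qed.

Lemma poly_eval_shift c e p :
  poly_eval (shift_poly c e p) = (c%:~R * v ^ e) *: poly_eval p.
Proof.
elim: p => [|[[c' e'] w'] p IHp] /=; first by rewrite scaler0.
by rewrite IHp scalerDr scalerA intrM (expfzDr _ _ v_neq0) mulrACA.
Qed.

Lemma poly_eval_scale s p :
  poly_eval (scale_poly s p) = scalar_eval s *: poly_eval p.
Proof.
elim: s p => [e|s IHs t IHt|s IHs t IHt] p /=.
- by rewrite poly_eval_shift mul1r.
- by rewrite poly_eval_add IHs IHt scalerDl.
- by rewrite IHs IHt scalerA.
Qed.

Lemma poly_eval_mul mul_l p e :
    (forall w i, poly_eval (mul_l w i) = word_eval w * nth 0 env i) ->
  poly_eval (mul_poly mul_l p e) = poly_eval p * nc_eval e.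
Proof.
move=> mulE.
elim: e p => [i||| a IHa b IHb|a IHa|a IHa b IHb|s a IHa] p /=.
- elim: p => [|[[c e] w] p IHp] /=; first by rewrite mul0r.
  by rewrite poly_eval_add poly_eval_shift mulE IHp mulrDl scalerAl.
- by rewrite mulr1.
- by rewrite mulr0.
- by rewrite poly_eval_add IHa IHb mulrDr.
- by rewrite poly_eval_shift IHa expr0z mulr1 scaleN1r mulrN.
- by rewrite IHb IHa mulrA.
- by rewrite IHa poly_eval_scale -scalerAl scalerAr.
Qed.

Lemma lookupP l a i e : rules_hold l -> lookup a i l = Some e ->
  nth 0 env a * nth 0 env i = nc_eval e.
Proof.
elim: l => [|[[a' i'] e'] l IHl] //= [eqn hl].
by case: andP => [[/eqP-> /eqP->] [<-]|_ /(IHl hl)].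
Qed.

Lemma poly_eval_word w : poly_eval [:: (1, 0, w)] = word_eval w.
Proof. by rewrite /= expr0z mulr1 scale1r addr0. Qed.

Lemma poly_eval_mul_letter rs n w i : rules_hold rs ->
  poly_eval (mul_letter rs n w i) = word_eval w * nth 0 env i.
Proof.
move=> rsP; elim: n w i => [|n IHn] [|a w] i; rewrite ?poly_eval_word //.
rewrite [mul_letter _ _ _ _]/=.
case eq_e: (lookup a i rs) => [e|]; rewrite ?poly_eval_word //.
rewrite (poly_eval_mul _ _ IHn) poly_eval_word /= -mulrA.
by rewrite (lookupP rsP eq_e).
Qed.

Lemma normalise_sound rs e1 e2 : rules_hold rs ->
  normalise rs (NAdd e1 (NOpp e2)) = [::] -> nc_eval e1 = nc_eval e2.
Proof.
move=> rsP /(congr1 poly_eval).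
rewrite (poly_eval_mul _ _ (fun w i => poly_eval_mul_letter 100 w i rsP)).
by rewrite poly_eval_word mul1r /= => /subr0_eq.
Qed.

End Soundness.

Ltac nc_index a l :=
  lazymatch l with
  | a :: _ => constr:(O)
  | _ :: ?l' => let n := nc_index a l' in constr:(S n)
  end.

Ltac nc_insert a l :=
  match l with
  | _ => let n := nc_index a l in l
  | _ => constr:(a :: l)
  end.

Ltac nc_letters t l :=
  lazymatch t with
  | 1 => l
  | 0 => l
  | ?a + ?b => let l := nc_letters a l in nc_letters b l
  | ?a * ?b => let l := nc_letters a l in nc_letters b l
  | - ?a => nc_letters a l
  | _ *: ?a => nc_letters a l
  | ?a ^+ 2 => nc_letters a l
  | _ => nc_insert t l
  end.

Ltac nc_scalar s :=
  lazymatch s with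
  | v => constr:(SV (Posz 1))
  | 1 => constr:(SV (Posz 0))
  | v^-1 => constr:(SV (Negz 0))
  | v ^+ ?n => constr:(SV (Posz n))
  | v ^- ?n.+1 => constr:(SV (Negz n))
  | v ^ ?n => constr:(SV n)
  | ?a + ?b =>
      let a := nc_scalar a in let b := nc_scalar b in constr:(SAdd a b)
  | ?a * ?b =>
      let a := nc_scalar a in let b := nc_scalar b in constr:(SMul a b)
  end.

Ltac nc_reify l t :=
  lazymatch t with
  | 1 => constr:(NOne)
  | 0 => constr:(NZero)
  | ?a + ?b =>
      let a := nc_reify l a in let b := nc_reify l b in constr:(NAdd a b)
  | ?a * ?b =>
      let a := nc_reify l a in let b := nc_reify l b in constr:(NMul a b)
  | - ?a => let a := nc_reify l a in constr:(NOpp a)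
  | ?s *: ?a =>
      let s := nc_scalar s in let a := nc_reify l a in constr:(NScale s a)
  | ?a ^+ 2 => let a := nc_reify l a in constr:(NMul a a)
  | _ => let n := nc_index t l in constr:(NVar n)
  end.

Ltac nc_rule_letters r l :=
  lazymatch r with
  | (?r1, ?r2) => let l := nc_rule_letters r1 l in nc_rule_letters r2 l
  | _ =>
      lazymatch type of r with
      | ?a * ?b = ?rhs =>
          let l := nc_insert a l in let l := nc_insert b l in nc_letters rhs l
      end
  end.

Ltac nc_rules r l acc :=
  lazymatch r with
  | (?r1, ?r2) => let acc := nc_rules r2 l acc in nc_rules r1 l acc
  | _ =>
      lazymatch type of r with
      | ?a * ?b = ?rhs =>
          let i := nc_index a l in
          let j := nc_index b l in
          let e := nc_reify l rhs in
          lazymatch acc with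
          | (?rs, ?pf) => constr:(((i, j, e) :: rs, conj r pf))
          end
      end
  end.

(** nc r proves an equation in an algebra over Q(v) by rewriting both sides to
    normal form, where r is a tuple of equations a * b = e between letters a, b
    and expressions e: a subterm that is not built by the operations of the
    algebra counts as a letter. *)
Tactic Notation "nc" constr(r) :=
  lazymatch goal with
  | |- @eq ?A ?lhs ?rhs =>
      let l := nc_rule_letters r constr:(@nil A) in
      let l := nc_letters lhs l in
      let l := nc_letters rhs l in
      lazymatch nc_rules r l constr:((@nil nc_rule, I)) with
      | (?rs, ?pf) =>
          let e1 := nc_reify l lhs in
          let e2 := nc_reify l rhs in
          exact (@normalise_sound _ l rs e1 e2 pf
            (@erefl nc_poly [::] <:
               normalise rs (NAdd e1 (NOpp e2)) = [::]))
      end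
  end.

(** * Quantum integers *)

Local Notation "[2]" := (v + v^-1).
Local Notation "[3]" := (v ^+ 2 + 1 + v ^- 2).

Lemma v_poly_neq0 (p : {poly rat}) : p.[0] != 0 -> tofrac p != 0.
Proof. by rewrite tofrac_eq0; apply: contraNneq => ->; rewrite horner0. Qed.

Lemma qint2_neq0 : [2] != 0.
Proof.
have: tofrac ('X^2 + 1 : {poly rat}) != 0 by rewrite v_poly_neq0 // !hornerE.
rewrite rmorphD rmorphXn rmorph1 -/v; apply: contraNneq => v2.
by rewrite -[1](mulfV v_neq0) expr2 -mulrDr v2 mulr0.
Qed.

Lemma qint3_neq0 : [3] != 0.
Proof.
have: tofrac ('X^2 ^+ 2 + 'X^2 + 1 : {poly rat}) != 0.
  by rewrite v_poly_neq0 // !hornerE.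
rewrite 2!rmorphD !rmorphXn rmorph1 -/v; apply: contraNneq => v3.
rewrite -[1](mulfV (expf_neq0 2 v_neq0)) -{2}[v ^+ 2]mulr1 expr2 -!mulrDr.
by rewrite v3 mulr0.
Qed.

Lemma qint2E : qint 2 = [2].
Proof.
have vV : v - v^-1 != 0.
  have: tofrac ('X^2 - 1 : {poly rat}) != 0 by rewrite v_poly_neq0 // !hornerE.
  rewrite rmorphB rmorphXn rmorph1 -/v; apply: contraNneq => v1.
  by rewrite -[1](mulfV v_neq0) expr2 -mulrBr v1 mulr0.
apply: (mulIf vV); rewrite /qint divfK // -[v ^ (- 2)]/(v ^+ 2)^-1 -exprVn.
by rewrite mulrC -subr_sqr.
Qed.

(** * The relations of degree at most one in B_0 *)

Definition serre (A : algType Qv) (x b : A) : A :=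
  b * x ^+ 2 - [2] *: (x * b * x) + x ^+ 2 * b.

Definition Kweight (A : algType Qv) (k l : A) (n : int) (u : A) : Prop :=
  u * k = v ^ n *: (k * u) /\ u * l = v ^ (- n) *: (l * u).

Local Notation Krules h := (proj1 h, proj2 h).

(** The letters x, y, b, k, l stand for B_1, B_2, B_0, K_1, K_2.  Everything up
    to the quadratic relations uses these relations only, and they are
    invariant under the diagram automorphism, which exchanges x with y and k
    with l. *)
Record linear_rel (A : algType Qv) (x y b k l : A) : Prop := LinearRel {
  rel_lk : l * k = k * l;
  rel_Kx : Kweight k l 3 x;
  rel_Ky : Kweight k l (- 3) y;
  rel_Kb : Kweight k l 0 b;
  rel_yxx : serre x y = - (([2] * v) *: (k * x + x * l));
  rel_xyy : serre y x = - (([2] * v) *: (l * y + y * k));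
  rel_bxx : serre x b = 0;
  rel_byy : serre y b = 0 }.

Lemma Kweight_sym (A : algType Qv) (k l u : A) n :
  Kweight k l n u -> Kweight l k (- n) u.
Proof. by case=> uk ul; split; rewrite ?opprK. Qed.

Lemma linear_rel_sym (A : algType Qv) (x y b k l : A) :
  linear_rel x y b k l -> linear_rel y x b l k.
Proof.
case=> lk Kx Ky Kb *; split=> //.
- exact (Kweight_sym Ky).
- exact (Kweight_sym Kx).
- exact (Kweight_sym Kb).
Qed.

Lemma Kweight_inv (A : algType Qv) (k l k' l' u : A) n :
    k * k' = 1 -> k' * k = 1 -> l * l' = 1 -> l' * l = 1 ->
  Kweight k l n u -> Kweight k' l' (- n) u.
Proof.
move=> kk' k'k ll' l'l [uk ul].
have inv (p q : A) m : p * q = 1 -> q * p = 1 -> u * p = v ^ m *: (p * u) ->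
    u * q = v ^ (- m) *: (q * u).
  move=> pq qp up; apply: (scalerI (expfz_neq0 m v_neq0)).
  rewrite scalerA -expfzDr ?v_neq0 // subrr expr0z scale1r.
  rewrite -[RHS]mulr1 -pq mulrA -(mulrA q) up -scalerAr -scalerAl mulrA qp.
  by rewrite mul1r.
by split; apply: inv; eassumption.
Qed.

Lemma comm_inv (A : nzRingType) (p q u : A) :
  p * q = 1 -> q * p = 1 -> u * p = p * u -> u * q = q * u.
Proof.
move=> pq qp up.
by rewrite -[RHS]mulr1 -pq mulrA -(mulrA q) up mulrA qp mul1r.
Qed.

Section RootVectors.
Variable A : algType Qv.

(** With this additional letter, the cubic Serre relations between x and y become
    rules for pairs of letters. *)
Definition fin21 (x y : A) := y * x - v *: (x * y).

(** The suffix lists the letters by which b is multiplied in turn: these are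
    root vectors for alpha_0 + alpha_1, delta, delta + alpha_1 and
    delta + alpha_1 + alpha_2.  Each is what remains of the previous vector
    times the new letter after removing the v-commuting term and, from aff12 on,
    the lowered term, which carries a factor k or l. *)
Definition aff1 (x b : A) := b * x - v *: (x * b).
Definition aff12 (x y b k : A) :=
  aff1 x b * y - v ^+ 2 *: (y * aff1 x b) - v *: (k * b).
Definition aff121 (x y b k l : A) :=
  aff12 x y b k * x - x * aff12 x y b k - ([2] * v^-1) *: (l * aff1 x b).
Definition aff1212 (x y b k l : A) :=
  aff121 x y b k l * y - v *: (y * aff121 x y b k l) - k * aff12 y x b l.

Lemma fin21_intro x y : y * x = v *: (x * y) + fin21 x y.
Proof. by rewrite addrC subrK. Qed.

Lemma aff1_intro x b : b * x = v *: (x * b) + aff1 x b.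
Proof. by rewrite addrC subrK. Qed.

Lemma aff12_intro x y b k :
  aff1 x b * y = v ^+ 2 *: (y * aff1 x b) + aff12 x y b k + v *: (k * b).
Proof. by rewrite -addrA subrK addrC subrK. Qed.

Lemma aff121_intro x y b k l :
  aff12 x y b k * x =
  x * aff12 x y b k + aff121 x y b k l + ([2] * v^-1) *: (l * aff1 x b).
Proof. by rewrite -addrA subrK addrC subrK. Qed.

Lemma aff1212_intro x y b k l :
  aff121 x y b k l * y =
  v *: (y * aff121 x y b k l) + aff1212 x y b k l + k * aff12 y x b l.
Proof. by rewrite -addrA subrK addrC subrK. Qed.

End RootVectors.

Section WeightOneTable.
Variables (A : algType Qv) (x y b k l : A).
Hypothesis R : linear_rel x y b k l.

Local Notation D := (fin21 x y).
Local Notation Y := (aff1 x b).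
Local Notation W := (aff12 x y b k).
Local Notation G := (aff121 x y b k l).

Local Notation rules :=
  (rel_lk R, Krules (rel_Kx R), Krules (rel_Ky R), Krules (rel_Kb R)).

Lemma fin21_x :
  D * x = v^-1 *: (x * D) - ([2] * v) *: (k * x) - ([2] * v ^- 2) *: (l * x).
Proof.
apply: subr0_eq; rewrite -(subrr (serre x y)) {2}(rel_yxx R) /fin21 /serre.
nc rules.
Qed.

Lemma y_fin21 :
  y * D = v^-1 *: (D * y) - ([2] * v) *: (l * y) - ([2] * v ^- 2) *: (k * y).
Proof.
apply: subr0_eq; rewrite -(subrr (serre y x)) {2}(rel_xyy R) /fin21 /serre.
nc rules.
Qed.

Lemma aff1_x : Y * x = v^-1 *: (x * Y).
Proof. apply: subr0_eq; rewrite -(rel_bxx R) /serre; nc (aff1_intro x b). Qed.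

Lemma Kweight_fin21 : Kweight k l 0 D.
Proof. split; rewrite /fin21; nc rules. Qed.

Lemma Kweight_aff1 : Kweight k l 3 Y.
Proof. split; rewrite /aff1; nc rules. Qed.

Lemma Kweight_aff12 : Kweight k l 0 W.
Proof. split; rewrite /aff12; nc (rules, Krules Kweight_aff1). Qed.

Lemma Kweight_aff121 : Kweight k l 3 G.
Proof.
by split; rewrite /aff121;
  nc (rules, Krules Kweight_aff1, Krules Kweight_aff12).
Qed.

End WeightOneTable.

Section LowTable.
Variables (A : algType Qv) (x y b k l : A).
Hypothesis R : linear_rel x y b k l.
Let R' := linear_rel_sym R.

Local Notation Y := (aff1 x b).
Local Notation P := (aff1 y b).
Local Notation V := (aff12 y x b l).
Local Notation G := (aff121 x y b k l).
Local Notation H := (aff121 y x b l k).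
Local Notation Z := (aff1212 x y b k l).

Lemma Kweight_aff1_swap : Kweight k l (- 3) P.
Proof. exact (Kweight_sym (Kweight_aff1 R')). Qed.

Lemma Kweight_aff12_swap : Kweight k l 0 V.
Proof. exact (Kweight_sym (Kweight_aff12 R')). Qed.

Lemma Kweight_aff121_swap : Kweight k l (- 3) H.
Proof. exact (Kweight_sym (Kweight_aff121 R')). Qed.

Local Notation rules :=
  (rel_lk R, Krules (rel_Kx R), Krules (rel_Ky R), Krules (rel_Kb R),
   Krules (Kweight_fin21 R), Krules (Kweight_aff1 R), Krules Kweight_aff1_swap,
   Krules (Kweight_aff12 R), Krules Kweight_aff12_swap,
   Krules (Kweight_aff121 R), Krules Kweight_aff121_swap,
   fin21_intro x y, fin21_x R, y_fin21 R, aff1_intro x b, aff1_intro y b,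
   aff1_x R, aff1_x R', aff12_intro x y b k, aff12_intro y x b l,
   aff121_intro x y b k l, aff121_intro y x b l k).

Lemma Kweight_aff1212 : Kweight k l 0 Z.
Proof. split; rewrite /aff1212; nc rules. Qed.

(** The Serre relation between x and y, multiplied on the left by b. *)
Lemma aff12_swap_x : V * x = x * V + [2] *: G + v^-1 *: (l * Y).
Proof.
apply: subr0_eq.
rewrite -(mulr0 b) -(subrr (serre x y)) {2}(rel_yxx R) /serre.
nc rules.
Qed.

(** The same Serre relation, multiplied on the left by Y. *)
Lemma aff121_x : G * x = v ^- 2 *: (x * G).
Proof.
apply: subr0_eq.
rewrite -(mulr0 Y) -(subrr (serre x y)) {2}(rel_yxx R) /serre.
nc rules.
Qed.

End LowTable.

Section TopTable.
Variables (A : algType Qv) (x y b k l : A).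
Hypothesis R : linear_rel x y b k l.
Let R' := linear_rel_sym R.

Local Notation Y := (aff1 x b).
Local Notation W := (aff12 x y b k).
Local Notation V := (aff12 y x b l).
Local Notation G := (aff121 x y b k l).
Local Notation H := (aff121 y x b l k).
Local Notation Z := (aff1212 x y b k l).

Local Notation rules :=
  (rel_lk R, Krules (rel_Kx R), Krules (rel_Ky R), Krules (rel_Kb R),
   Krules (Kweight_fin21 R), Krules (Kweight_aff1 R),
   Krules (Kweight_aff1_swap R), Krules (Kweight_aff12 R),
   Krules (Kweight_aff12_swap R), Krules (Kweight_aff121 R),
   Krules (Kweight_aff121_swap R), Krules (Kweight_aff1212 R),
   fin21_intro x y, fin21_x R, y_fin21 R, aff1_intro x b, aff1_intro y b,
   aff1_x R, aff1_x R', aff12_intro x y b k, aff12_intro y x b l,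
   aff121_intro x y b k l, aff121_intro y x b l k,
   aff12_swap_x R, aff12_swap_x R', aff121_x R, aff121_x R',
   aff1212_intro x y b k l).

(** The Serre relation between y and x, multiplied on the left by Y, gives [2]
    times this identity.  It says that Z, defined from G and y, is also what H
    and x produce; hence the symmetry of Z. *)
Lemma aff121_swap_x : H * x = v *: (x * H) + Z + l * W.
Proof.
apply: (scalerI qint2_neq0); apply: subr0_eq.
rewrite -(mulr0 Y) -(subrr (serre y x)) {2}(rel_xyy R) /serre.
nc rules.
Qed.

Lemma aff1212_sym : aff1212 y x b l k = Z.
Proof. rewrite {1}/aff1212; nc aff121_swap_x. Qed.

(** Z is a highest vector, so multiplication by x only lowers it to G; the
    Serre relation multiplied by V gives - [3] times this identity. *)
Lemma aff1212_x : Z * x = v^-1 *: (x * Z) + v ^- 2 *: (l * G).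
Proof.
apply: (scalerI qint3_neq0); apply: subr0_eq; rewrite -oppr0.
rewrite -(mulr0 V) -(subrr (serre x y)) {2}(rel_yxx R) /serre.
nc (rules, aff121_swap_x).
Qed.

End TopTable.

Lemma aff1212_y (A : algType Qv) (x y b k l : A) : linear_rel x y b k l ->
  aff1212 x y b k l * y =
  v^-1 *: (y * aff1212 x y b k l) + v ^- 2 *: (k * aff121 y x b l k).
Proof.
by move=> R; rewrite -(aff1212_sym R); apply: aff1212_x (linear_rel_sym R).
Qed.

(** * The relations of degree two in B_0 *)

Section Quadratic.
Variables (A : algType Qv) (x y b k l c : A).
Hypothesis R : linear_rel x y b k l.
Let R' := linear_rel_sym R.

Local Notation Y := (aff1 x b).
Local Notation G := (aff121 x y b k l).
Local Notation Z := (aff1212 x y b k l).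

(** The products by x and y on the right, for b and the seven vectors derived
    from it, with the rules that bring products into the order k, l, x, fin21, y
    and then these vectors. *)
Local Notation table :=
  (rel_lk R, Krules (rel_Kx R), Krules (rel_Ky R), Krules (rel_Kb R),
   Krules (Kweight_fin21 R), Krules (Kweight_aff1 R),
   Krules (Kweight_aff1_swap R), Krules (Kweight_aff12 R),
   Krules (Kweight_aff12_swap R), Krules (Kweight_aff121 R),
   Krules (Kweight_aff121_swap R), Krules (Kweight_aff1212 R),
   fin21_intro x y, fin21_x R, y_fin21 R, aff1_intro x b, aff1_intro y b,
   aff1_x R, aff1_x R', aff12_intro x y b k, aff12_intro y x b l,
   aff121_intro x y b k l, aff121_intro y x b l k,
   aff12_swap_x R, aff12_swap_x R', aff121_x R, aff121_x R',
   aff1212_intro x y b k l, aff121_swap_x R, aff1212_x R, aff1212_y R).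

(** Expanding the nested brackets with the table leaves Z alone. *)
Lemma aff1212E :
  Z = v *: bracket (bracket (qbracket v b x) y) (qbracket v y x)
      - bracket b (qbracket (v ^+ 3) y x) * k + v *: (b * k * l).
Proof. rewrite /bracket /qbracket; nc table. Qed.

Hypothesis c_comm :
  [/\ x * c = c * x, y * c = c * y, k * c = c * k & l * c = c * l].
Hypothesis bY : b * Y - v^-1 *: (Y * b) = - (v^-1 *: (c * x)).

(** The left-hand sides of the two quadratic Serre relations behave like lowest
    weight vectors of ten-dimensional representations of sl_3, whose weights
    all have multiplicity one.  From the one for x, three raising steps in the
    direction of y and then three in the direction of x lead to the highest
    vector, which is the relation between G and Z.  Multiplying by x raises in
    the direction of x, but also, with a factor l, lowers in the direction of
    y; the vectors e1, f1, f2 serve to cancel these lowered parts. *)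
Lemma aff121_aff1212 :
  G * Z = v^-1 *: (Z * G) + v ^+ 2 *: (c * (k * k * l * x)).
Proof.
case: c_comm => xc yc kc lc.
(* The six steps multiply the relation by [2]^2 [3]^2. *)
apply: (scalerI qint3_neq0); apply: (scalerI qint3_neq0).
apply: (scalerI qint2_neq0); apply: (scalerI qint2_neq0).
apply: subr0_eq.
pose d0 := b * Y - v^-1 *: (Y * b) + v^-1 *: (c * x).
(* On a vector of weight beta, the step towards beta + alpha_i v-commutes with
   the power - (beta, alpha_i); here beta starts at 2 alpha_0 + alpha_1. *)
pose d1 := d0 * y - v ^+ 3 *: (y * d0).
pose d2 := d1 * y - v *: (y * d1).
pose d3 := d2 * y - v^-1 *: (y * d2).
pose e1 := d1 * x - v *: (x * d1) - [3] *: (l * d0).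
pose f1 := d2 * x - v ^+ 2 *: (x * d2) - ([2] * [2] * v) *: (l * d1).
pose f2 := f1 * x - x * f1 - ([2] * [2] * v^-1) *: (l * e1).
pose d4 := d3 * x - v ^+ 3 *: (x * d3) - ([3] * v ^+ 2) *: (l * d2).
pose d5 := d4 * x - v *: (x * d4) - [3] *: (l * f1).
pose d6 := d5 * x - v^-1 *: (x * d5) - ([3] * v ^- 2) *: (l * f2).
have d0E : d0 = 0 by rewrite /d0 bY addNr.
have <- : d6 = 0.
  rewrite /d6 /f2 /d5 /f1 /d4 /e1 /d3 /d2 /d1 d0E.
  by rewrite !(mul0r, mulr0, scaler0, subr0).
rewrite /d6 /f2 /d5 /f1 /d4 /e1 /d3 /d2 /d1 /d0.
nc (table, xc, yc, kc, lc).
Qed.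

End Quadratic.

(** * The transformed generators *)

Lemma ordI3P (Q : 'I_3 -> Prop) : Q i0 -> Q i1 -> Q i2 -> forall i, Q i.
Proof.
by move=> Q0 Q1 Q2 [[|[|[|//]]] lt_i]; [move: Q0|move: Q1|move: Q2];
  congr Q; apply: val_inj.
Qed.

Lemma tau0 : tau i0 = i0. Proof. by rewrite tpermD. Qed.
Lemma tau1 : tau i1 = i2. Proof. by rewrite tpermL. Qed.
Lemma tau2 : tau i2 = i1. Proof. by rewrite tpermR. Qed.

Section Family.
Variables (A : algType Qv) (B K KV : 'I_3 -> A).
Hypothesis F : iqg_family B K KV.

Local Notation x := (B i1).
Local Notation y := (B i2).
Local Notation b := (B i0).
Local Notation k := (K i1).
Local Notation l := (K i2).
Local Notation c := (K i0).
Local Notation k' := (KV i1).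
Local Notation l' := (KV i2).
Local Notation c' := (KV i0).

Lemma family_BK i j :
  B j * K i = v ^ (cartan i j - cartan (tau i) j) *: (K i * B j).
Proof.
rewrite (F (rel_KB B K KV i j)) scalerA -expfzDr ?v_neq0 //.
by rewrite addrC subrKA subrr expr0z scale1r.
Qed.

Lemma family_linear : linear_rel x y b k l.
Proof.
split; rewrite /serre -?qint2E.
- exact: (F (rel_KK B K KV i2 i1)).
- by split; rewrite family_BK ?tau1 ?tau2.
- by split; rewrite family_BK ?tau1 ?tau2.
- by split; rewrite family_BK ?tau1 ?tau2.
- by rewrite (F (rel_B2B1 B K KV)) -scalerDr scalerA.
- by rewrite (F (rel_B1B2 B K KV)) -scalerDr scalerA.
- exact: (F (rel_B0Bi B K KV (isT : i1 != i0))).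
- exact: (F (rel_B0Bi B K KV (isT : i2 != i0))).
Qed.

Lemma family_KKV i : K i * KV i = 1.
Proof. exact (F (rel_KKV B K KV i)). Qed.

Lemma family_KVK i : KV i * K i = 1.
Proof. exact (F (rel_KVK B K KV i)). Qed.

Lemma family_K_comm i j : K i * K j = K j * K i.
Proof. exact (F (rel_KK B K KV i j)). Qed.

Lemma family_KKV_comm i j : K i * KV j = KV j * K i.
Proof.
exact: (comm_inv (family_KKV j) (family_KVK j) (family_K_comm i j)).
Qed.

Lemma family_KV_comm i j : KV i * KV j = KV j * KV i.
Proof.
exact: (comm_inv (family_KKV j) (family_KVK j) (esym (family_KKV_comm j i))).
Qed.

Lemma family_BK0 j : B j * c = c * B j.
Proof. by rewrite family_BK tau0 subrr expr0z scale1r. Qed.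

Lemma family_Kweight_inv n u : Kweight k l n u -> Kweight k' l' (- n) u.
Proof.
exact: (Kweight_inv (family_KKV i1) (family_KVK i1) (family_KKV i2)
  (family_KVK i2)).
Qed.

Local Notation D := (fin21 x y).
Local Notation Y := (aff1 x b).
Local Notation G := (aff121 x y b k l).
Local Notation H := (aff121 y x b l k).
Local Notation Z := (aff1212 x y b k l).

Definition braidB (i : 'I_3) : A :=
  match nat_of_ord i with
  | 0 => Z
  | 1 => - (v ^- 2 *: (x * l'))
  | _ => - (v ^- 2 *: (y * k'))
  end.

Definition braidK (i : 'I_3) : A :=
  match nat_of_ord i with
  | 0 => v ^+ 2 *: (c * k ^+ 2 * l ^+ 2)
  | 1 => v^-1 *: l'
  | _ => v^-1 *: k'
  end.

Definition braidKV (i : 'I_3) : A :=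
  match nat_of_ord i with
  | 0 => v ^- 2 *: (c' * k' ^+ 2 * l' ^+ 2)
  | 1 => v *: l
  | _ => v *: k
  end.

Let R := family_linear.
Let R' := linear_rel_sym R.

Lemma family_aff1212_K0 : Z * c = c * Z.
Proof.
rewrite /aff1212 /aff121 /aff12 /aff1.
nc (family_K_comm i1 i0, family_K_comm i2 i0, family_BK0 i0, family_BK0 i1,
    family_BK0 i2).
Qed.

Lemma serre_aff1 u : u * b ^+ 2 - qint 2 *: (b * u * b) + b ^+ 2 * u =
    - (v^-1 *: (c * u)) ->
  b * aff1 u b - v^-1 *: (aff1 u b * b) = - (v^-1 *: (c * u)).
Proof. by move=> <-; rewrite qint2E /aff1; nc (family_BK0 i0). Qed.

Lemma family_GZ : G * Z = v^-1 *: (Z * G) + v ^+ 2 *: (c * (k * k * l * x)).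
Proof.
apply: (aff121_aff1212 R).
  by split; rewrite ?family_BK0 //; apply: family_K_comm.
exact: serre_aff1 (F (rel_BiB0 B K KV (isT : i1 != i0))).
Qed.

Lemma family_HZ : H * Z = v^-1 *: (Z * H) + v ^+ 2 *: (c * (l * l * k * y)).
Proof.
rewrite -(aff1212_sym R); apply: (aff121_aff1212 R').
  by split; rewrite ?family_BK0 //; apply: family_K_comm.
exact: serre_aff1 (F (rel_BiB0 B K KV (isT : i2 != i0))).
Qed.

Local Notation KKVrules h :=
  (proj1 h, proj2 h, proj1 (family_Kweight_inv (h)),
   proj2 (family_Kweight_inv (h))).

Local Notation rules :=
  (family_KKV i1, family_KVK i1, family_KKV i2, family_KVK i2,
   family_K_comm i2 i1, esym (family_KKV_comm i1 i2), family_KKV_comm i2 i1,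
   family_KV_comm i2 i1, family_K_comm i1 i0, family_K_comm i2 i0,
   esym (family_KKV_comm i0 i1), esym (family_KKV_comm i0 i2),
   family_BK0 i1, family_BK0 i2, family_BK0 i0, family_aff1212_K0,
   KKVrules (rel_Kx R), KKVrules (rel_Ky R), KKVrules (rel_Kb R),
   KKVrules (Kweight_fin21 R), KKVrules (Kweight_aff121 R),
   KKVrules (Kweight_aff121_swap R), KKVrules (Kweight_aff1212 R),
   fin21_intro x y, fin21_x R, y_fin21 R, aff121_x R, aff121_x R',
   aff1212_intro x y b k l, aff121_swap_x R, aff1212_x R, aff1212_y R,
   family_GZ, family_HZ).

(** Since Z * x - v^-1 x * Z is a multiple of l * G, and G v-commutes with x,
    the cubic Serre relation for x and Z follows at once; for the same reason
    the one quadratic in Z reduces to the relation between G and Z. *)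
Lemma braid_family : iqg_family braidB braidK braidKV.
Proof.
move=> _ _ [i|i|i j|i j|||i|i]; rewrite ?qint2E.
- elim/ordI3P: i; rewrite /braidK /braidKV /=; [|nc rules|nc rules].
  nc (rules, family_KKV i0, family_KKV_comm i1 i0, family_KKV_comm i2 i0).
- elim/ordI3P: i; rewrite /braidK /braidKV /=; [|nc rules|nc rules].
  nc (rules, family_KVK i0).
- elim/ordI3P: i; elim/ordI3P: j; rewrite /braidK /=; nc rules.
- elim/ordI3P: i; elim/ordI3P: j;
    rewrite /braidK /braidB ?tau0 ?tau1 ?tau2 /=; nc rules.
- rewrite /braidB /braidK /=; nc rules.
- rewrite /braidB /braidK /=; nc rules.
- elim/ordI3P: i => // _; rewrite /braidB /=; nc rules.
- elim/ordI3P: i => // _; rewrite /braidB /braidK /=; nc rules.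
Qed.

End Family.

(** * The automorphism and its inverse *)

HB.instance Definition _ :=
  GRing.isLinear.Build Qv iqg iqg *:%R sigma_tau sigma_tau_linear.

Lemma sigma_tauD u w : sigma_tau (u + w) = sigma_tau u + sigma_tau w.
Proof. exact: raddfD. Qed.

Lemma sigma_tauB u w : sigma_tau (u - w) = sigma_tau u - sigma_tau w.
Proof. exact: raddfB. Qed.

Lemma sigma_tauN u : sigma_tau (- u) = - sigma_tau u.
Proof. exact: raddfN. Qed.

Lemma sigma_tauZ a u : sigma_tau (a *: u) = a *: sigma_tau u.
Proof. exact: linearZ_LR. Qed.

Lemma sigma_bracket u w :
  sigma_tau (bracket u w) = bracket (sigma_tau w) (sigma_tau u).
Proof. by rewrite /bracket sigma_tauB !sigma_tauM. Qed.

Lemma sigma_qbracket a u w :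
  sigma_tau (qbracket a u w) = qbracket a (sigma_tau w) (sigma_tau u).
Proof. by rewrite /qbracket sigma_tauB sigma_tauZ !sigma_tauM. Qed.

Definition braid : {lrmorphism iqg -> iqg} := iqg_lift (braid_family iqg_familyP).

Lemma braid_iB i : braid (iB i) = braidB iB iK iKV i.
Proof. exact: iqg_lift_iB. Qed.

Lemma braid_iK i : braid (iK i) = braidK iK iKV i.
Proof. exact: iqg_lift_iK. Qed.

Lemma braid_iKV i : braid (iKV i) = braidKV iK iKV i.
Proof. exact: iqg_lift_iKV. Qed.

Definition braid_inv (u : iqg) : iqg := sigma_tau (braid (sigma_tau u)).

Lemma braid_inv_additive : {morph braid_inv : u w / u - w}.
Proof. by move=> u w; rewrite /braid_inv sigma_tauB raddfB sigma_tauB. Qed.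

Lemma braid_inv_monoid : monoid_morphism braid_inv.
Proof.
by split=> [|u w]; rewrite /braid_inv;
  [rewrite sigma_tau1 rmorph1 sigma_tau1|rewrite sigma_tauM rmorphM sigma_tauM].
Qed.

Lemma braid_inv_scalable : scalable braid_inv.
Proof. by move=> a u; rewrite /braid_inv sigma_tauZ linearZ_LR sigma_tauZ. Qed.

HB.instance Definition _ :=
  GRing.isZmodMorphism.Build iqg iqg braid_inv braid_inv_additive.
HB.instance Definition _ :=
  GRing.isMonoidMorphism.Build iqg iqg braid_inv braid_inv_monoid.
HB.instance Definition _ :=
  GRing.isScalable.Build Qv iqg iqg *:%R braid_inv braid_inv_scalable.

(** Unlike braid, phi permutes the eight root vectors: it matches a v-commutator
    that raises with one that lowers, the two factors being reversed. *)
Definition phi (u : iqg) : iqg := braid (sigma_tau u).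

Lemma phi_linear : linear phi.
Proof. by move=> a u w; rewrite /phi sigma_tau_linear linearP. Qed.

Lemma phiB u w : phi (u - w) = phi u - phi w.
Proof. by rewrite /phi sigma_tauB raddfB. Qed.

Lemma phiN u : phi (- u) = - phi u.
Proof. by rewrite /phi sigma_tauN raddfN. Qed.

Lemma phiZ a u : phi (a *: u) = a *: phi u.
Proof. by rewrite /phi sigma_tauZ linearZ_LR. Qed.

Lemma phiM u w : phi (u * w) = phi w * phi u.
Proof. by rewrite /phi sigma_tauM rmorphM. Qed.

Lemma phi_sqr u : phi (u ^+ 2) = phi u ^+ 2.
Proof. by rewrite !expr2 phiM. Qed.

Lemma phi_iB i : phi (iB i) = braidB iB iK iKV i.
Proof. by rewrite /phi sigma_tau_iB braid_iB. Qed.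

Lemma phi_iK i : phi (iK i) = braidK iK iKV (tau i).
Proof. by rewrite /phi sigma_tau_iK braid_iK. Qed.

Lemma phi_iKV i : phi (iKV i) = braidKV iK iKV (tau i).
Proof. by rewrite /phi sigma_tau_iKV braid_iKV. Qed.

Section PhiInvolution.

Local Notation x := (iB i1).
Local Notation y := (iB i2).
Local Notation b := (iB i0).
Local Notation k := (iK i1).
Local Notation l := (iK i2).
Local Notation c := (iK i0).
Local Notation k' := (iKV i1).
Local Notation l' := (iKV i2).
Local Notation c' := (iKV i0).
Local Notation Y := (aff1 x b).
Local Notation P := (aff1 y b).
Local Notation W := (aff12 x y b k).
Local Notation V := (aff12 y x b l).
Local Notation G := (aff121 x y b k l).
Local Notation H := (aff121 y x b l k).
Local Notation Z := (aff1212 x y b k l).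

Let F := iqg_familyP.
Let R := family_linear F.
Let R' := linear_rel_sym R.

Lemma phi_b : phi b = Z. Proof. exact: phi_iB. Qed.
Lemma phi_x : phi x = - (v ^- 2 *: (x * l')). Proof. exact: phi_iB. Qed.
Lemma phi_y : phi y = - (v ^- 2 *: (y * k')). Proof. exact: phi_iB. Qed.
Lemma phi_c : phi c = v ^+ 2 *: (c * k ^+ 2 * l ^+ 2).
Proof. by rewrite phi_iK tau0. Qed.
Lemma phi_k : phi k = v^-1 *: k'. Proof. by rewrite phi_iK tau1. Qed.
Lemma phi_l : phi l = v^-1 *: l'. Proof. by rewrite phi_iK tau2. Qed.
Lemma phi_c' : phi c' = v ^- 2 *: (c' * k' ^+ 2 * l' ^+ 2).
Proof. by rewrite phi_iKV tau0. Qed.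
Lemma phi_k' : phi k' = v *: k. Proof. by rewrite phi_iKV tau1. Qed.
Lemma phi_l' : phi l' = v *: l. Proof. by rewrite phi_iKV tau2. Qed.

Local Notation phi_gen :=
  (phi_b, phi_x, phi_y, phi_c, phi_k, phi_l, phi_c', phi_k', phi_l').

Local Notation KKVrules h :=
  (proj1 h, proj2 h, proj1 (family_Kweight_inv F (h)),
   proj2 (family_Kweight_inv F (h))).

Local Notation rules :=
  (family_KKV F i1, family_KVK F i1, family_KKV F i2, family_KVK F i2,
   family_K_comm F i2 i1, esym (family_KKV_comm F i1 i2),
   family_KKV_comm F i2 i1, family_KV_comm F i2 i1,
   KKVrules (rel_Kx R), KKVrules (rel_Ky R), KKVrules (rel_Kb R),
   KKVrules (Kweight_aff1 R), KKVrules (Kweight_aff1_swap R),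
   KKVrules (Kweight_aff12 R), KKVrules (Kweight_aff12_swap R),
   KKVrules (Kweight_aff121 R), KKVrules (Kweight_aff121_swap R),
   KKVrules (Kweight_aff1212 R),
   aff12_intro x y b k, aff12_intro y x b l, aff121_intro x y b k l,
   aff121_intro y x b l k, aff12_swap_x R, aff12_swap_x R',
   aff121_swap_x R, aff1212_intro x y b k l, aff1212_x R, aff1212_y R).

(** The image of b * x - v x * b is, up to l^-1 and a scalar, the v-commutator
    of Z and x in which the l-term of the table survives. *)
Lemma phi_aff1 : phi Y = G.
Proof. rewrite {1}/aff1 !(phi_gen, phiB, phiZ, phiM); nc rules. Qed.

Lemma phi_aff1_swap : phi P = H.
Proof. rewrite {1}/aff1 !(phi_gen, phiB, phiZ, phiM); nc rules. Qed.

Lemma phi_aff12 : phi W = V.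
Proof.
rewrite {1}/aff12 !(phi_aff1, phi_gen, phiB, phiZ, phiM); nc rules.
Qed.

Lemma phi_aff12_swap : phi V = W.
Proof.
rewrite {1}/aff12 !(phi_aff1_swap, phi_gen, phiB, phiZ, phiM); nc rules.
Qed.

Lemma phi_aff121 : phi G = Y.
Proof.
rewrite {1}/aff121 !(phi_aff12, phi_aff1, phi_gen, phiB, phiZ, phiM).
nc rules.
Qed.

Lemma phi_aff1212 : phi Z = b.
Proof.
rewrite {1}/aff1212 !(phi_aff121, phi_aff12_swap, phi_gen, phiB, phiZ, phiM).
nc rules.
Qed.

Lemma phi_involutive : involutive phi.
Proof.
move=> u; elim/iqg_ind: u => [|i|i|i|a u w IHu IHw|u w IHu IHw].
- by rewrite /phi !(sigma_tau1, rmorph1).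
- elim/ordI3P: i.
  + by rewrite phi_b phi_aff1212.
  + by rewrite phi_x phiN phiZ phiM phi_x phi_l'; nc rules.
  + by rewrite phi_y phiN phiZ phiM phi_y phi_k'; nc rules.
- elim/ordI3P: i.
  + rewrite phi_c phiZ !(phi_sqr, phiM) phi_c phi_k phi_l.
    nc (rules, family_K_comm F i1 i0, family_K_comm F i2 i0,
        esym (family_KKV_comm F i0 i1), esym (family_KKV_comm F i0 i2)).
  + by rewrite phi_k phiZ phi_k'; nc rules.
  + by rewrite phi_l phiZ phi_l'; nc rules.
- elim/ordI3P: i.
  + rewrite phi_c' phiZ !(phi_sqr, phiM) phi_c' phi_k' phi_l'.
    nc (rules, family_KKV_comm F i1 i0, family_KKV_comm F i2 i0,
        family_KV_comm F i1 i0, family_KV_comm F i2 i0).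
  + by rewrite phi_k' phiZ phi_k; nc rules.
  + by rewrite phi_l' phiZ phi_l; nc rules.
- by rewrite !phi_linear IHu IHw.
- by rewrite !phiM IHu IHw.
Qed.

End PhiInvolution.

Lemma braidK_inv : cancel braid braid_inv.
Proof.
move=> u; rewrite /braid_inv -{1}[u]sigma_tauK -/(phi (sigma_tau u)).
by rewrite -/(phi (phi _)) phi_involutive sigma_tauK.
Qed.

Lemma braid_invK : cancel braid_inv braid.
Proof. exact: phi_involutive. Qed.

Theorem theoremA :
  exists T T' : {lrmorphism iqg -> iqg},
    [/\ cancel T T', cancel T' T,
        [/\ T (iK i1) = v^-1 *: iKV i2,
            T (iK i2) = v^-1 *: iKV i1 &
            T (iK i0) = v ^+ 2 *: (iK i0 * iK i1 ^+ 2 * iK i2 ^+ 2)] /\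
        [/\ T (iB i1) = - (v ^- 2 *: (iB i1 * iKV i2)),
            T (iB i2) = - (v ^- 2 *: (iB i2 * iKV i1)) &
            T (iB i0) =
              v *: bracket (bracket (qbracket v (iB i0) (iB i1)) (iB i2))
                           (qbracket v (iB i2) (iB i1))
              - bracket (iB i0) (qbracket (v ^+ 3) (iB i2) (iB i1)) * iK i1
              + v *: (iB i0 * iK i1 * iK i2)],
        [/\ T' (iK i1) = v^-1 *: iKV i2,
            T' (iK i2) = v^-1 *: iKV i1 &
            T' (iK i0) = v ^+ 2 *: (iK i0 * iK i1 ^+ 2 * iK i2 ^+ 2)] /\
        [/\ T' (iB i1) = - (v *: (iB i1 * iKV i1)),
            T' (iB i2) = - (v *: (iB i2 * iKV i2)) &
            T' (iB i0) =
              v *: bracket (qbracket v (iB i1) (iB i2))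
                           (bracket (iB i2) (qbracket v (iB i1) (iB i0)))
              - bracket (qbracket (v ^+ 3) (iB i1) (iB i2)) (iB i0) * iK i2
              + v *: (iB i0 * iK i1 * iK i2)] &
        T' =1 sigma_tau \o T \o sigma_tau].
Proof.
have F := iqg_familyP.
have R := family_linear F.
have sigma_gen :=
  (sigma_tau_iB, sigma_tau_iK, sigma_tau_iKV, tau0, tau1, tau2).
have braid_b := etrans (braid_iB i0) (aff1212E R).
exists braid, braid_inv; split=> //.
- exact: braidK_inv.
- exact: braid_invK.
- by split; split; rewrite ?braid_iK ?braid_b ?braid_iB.
- split; split; rewrite /= /braid_inv !sigma_gen.
  + by rewrite braid_iK sigma_tauZ !sigma_gen.
  + by rewrite braid_iK sigma_tauZ !sigma_gen.
  + rewrite braid_iK sigma_tauZ !expr2 !sigma_tauM !sigma_gen.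
    nc (family_K_comm F i2 i1, family_K_comm F i1 i0, family_K_comm F i2 i0).
  + rewrite braid_iB sigma_tauN sigma_tauZ sigma_tauM !sigma_gen.
    nc (proj1 (family_Kweight_inv F (rel_Kx R))).
  + rewrite braid_iB sigma_tauN sigma_tauZ sigma_tauM !sigma_gen.
    nc (proj2 (family_Kweight_inv F (rel_Ky R))).
  + rewrite braid_b sigma_tauD sigma_tauB !sigma_tauZ !sigma_tauM.
    rewrite !(sigma_bracket, sigma_qbracket, sigma_gen) /bracket /qbracket.
    nc (family_K_comm F i2 i1, Krules (rel_Kx R), Krules (rel_Ky R),
        Krules (rel_Kb R)).
Qed.
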